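(* Let $(r_i,m_i)$ be a sequence of pairs of positive integers with $\gcd(r_i,m_i)=1$, $m_i\to\infty$ and $\limsup_i H(r_i/m_i)>0$. Then there exist relatively prime positive integers $a,b$ with $a\le b$, a positive integer $c$, and an increasing sequence of indices $i_1<i_2<\cdots$ such that for all $j$, \[r_{i_j}=\frac{a\,m_{i_j}-c}{b},\qquad\text{and}\qquad H\!\left(\frac{r_{i_j}}{m_{i_j}}\right)\to\frac{1}{\max\{c,b\}}\ \text{ as } j\to\infty.\]
   Context: For relatively prime positive integers $r,m$, $H(r/m)=\min\{k/m+\{kr/m\}:1\le k<m\}$, where $\{x\}=x-\lfloor x\rfloor$ denotes the fractional part.
   Formalization: The formal theorem adds the assumption r_i ≤ m_i for all i; without it the claim fails, e.g. r_i = 2m_i − 1 has H(r_i/m_i) = 1, yet a ≤ b and c > 0 force (a m_i − c)/b < m_i ≤ r_i. *)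

(* Defs.v *)
From HB Require Import structures.
From mathcomp Require Import all_boot all_order all_algebra.
From mathcomp Require Import all_classical all_reals all_analysis.

Set Implicit Arguments.
Unset Strict Implicit.
Unset Printing Implicit Defensive.

Import Order.TTheory GRing.Theory Num.Theory.
Local Open Scope ring_scope.

Definition fracpart (R : realType) (x : R) : R := x - (Num.floor x)%:~R.

Definition Hterm (R : realType) (r m k : nat) : R :=
  k%:R / m%:R + fracpart (k%:R * r%:R / m%:R).

(* The seed of the iterated minimum is the value at k = 1, which already belongs
   to the range 1 <= k < m as soon as 1 < m, so it does not affect the minimum.
   For m = 1 the range is empty and the value, [Hterm R r 1 1], is a mere
   convention. *)
Definition H (R : realType) (r m : nat) : R :=
  \big[Num.min/Hterm R r m 1]_(1 <= k < m) Hterm R r m k.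

(* Main.v *)
(* Write s_k for k r mod m, so that m H is the minimum of k + s_k. By Dirichlet,
   some b r with b <= N is within m / N of a multiple of m; if H is bounded
   below, it lies below that multiple, b r = a m - c, and c is bounded too,
   since otherwise a multiple of b makes both coordinates small. By pigeonhole
   (a, b, c) can be fixed along a subsequence. Now c k + b s_k is a positive
   multiple of m, whence k + s_k >= m / max(b, c); on the line c k + b s = m the
   points (k, s_k) are spaced by (b, -c), so one lies within bounded distance
   of the axis intercept where k + s = m / max(b, c). *)
Require Import Defs.
From HB Require Import structures.
From mathcomp Require Import all_boot all_order all_algebra.
From mathcomp Require Import all_classical all_reals all_analysis.
From mathcomp Require Import zify ring lra.
Import Order.TTheory GRing.Theory Num.Theory.
Import numFieldNormedType.Exports.
Local Open Scope classical_set_scope.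
Local Open Scope ring_scope.
Set Implicit Arguments.
Unset Strict Implicit.

(** * Reduction of [H] to residues modulo [m] *)

Lemma Hterm_modn (R : realType) (r m k : nat) : (0 < m)%N ->
  Hterm R r m k = (k + (k * r) %% m)%N%:R / m%:R.
Proof.
move=> m0; have m0R : (m%:R : R) != 0 by rewrite pnatr_eq0 -lt0n.
rewrite /Hterm /fracpart -natrM.
have E : (k * r)%N%:R / m%:R =
    ((k * r) %/ m)%N%:R + ((k * r) %% m)%N%:R / m%:R :> R.
  by rewrite {1}(divn_eq (k * r) m) natrD natrM mulrDl mulfK.
rewrite (@floor_def _ _ ((k * r) %/ m)%N%:Z).
  by rewrite E -pmulrn natrD mulrDl addrAC subrr add0r.
rewrite intrD -!pmulrn E lerDl ltrD2l divr_ge0 //=.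
by rewrite ltr_pdivrMr ?ltr0n// mul1r ltr_nat ltn_mod.
Qed.

Lemma H_le (R : realType) (r m k : nat) : (0 < k < m)%N ->
  H R r m <= Hterm R r m k.
Proof.
move=> km; rewrite /H.
have : k \in index_iota 1 m by rewrite mem_index_iota.
elim: (index_iota 1 m) => // j s IH; rewrite inE big_cons ge_min.
by move=> /orP[/eqP->|/IH->]; rewrite ?lexx ?orbT.
Qed.

Lemma le_H (R : realType) (r m : nat) (x : R) : (1 < m)%N ->
  (forall k, (0 < k < m)%N -> x <= Hterm R r m k) -> x <= H R r m.
Proof.
move=> m1 h; rewrite /H big_nat; apply: (big_ind (fun y => x <= y)) => //.
- by apply: h.
- by move=> y z xy xz; rewrite le_min xy.
Qed.

(** * Diophantine approximation: the relation [a * m = b * r + c] *)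

(** The residues of the [N + 1] multiples [j * r], [0 <= j <= N], fall into [N] boxes of width
    [m / N], so two of them share a box, and [b] is the difference of their indices. Which of the
    two residues is larger decides the alternative. *)
Lemma dirichlet_modn (N r m : nat) : (0 < N)%N -> (0 < m)%N ->
  exists2 b, (0 < b <= N)%N &
    (N * ((b * r) %% m) < m)%N \/
    exists a c, [/\ (0 < c)%N, (N * c < m)%N & (a * m = b * r + c)%N].
Proof.
move=> N0 m0; pose y j := ((j * r) %% m)%N.
have box j : ((N * y j) %/ m < N)%N.
  by rewrite ltn_divLR// ltn_pmul2l// ltn_mod.
pose f (j : 'I_N.+1) := Ordinal (box j).
have /injectivePn[i [j ij fij]] : ~~ injectiveb f.
  apply/negP => /injectiveP /leq_card; rewrite !card_ord; lia.
wlog lij : i j ij fij / (i < j)%N.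
  move=> W; have [lij|lji|e] := ltngtP i j; first exact: (W i j).
    by apply: (W j i); rewrite // eq_sym.
  by move/eqP: ij; case; apply: val_inj.
move/(congr1 val): fij => /= fij.
have Ni := divn_eq (N * y i) m; have Nj := divn_eq (N * y j) m.
have li := ltn_pmod (N * y i) m0; have lj := ltn_pmod (N * y j) m0.
rewrite fij in Ni.
have di := divn_eq (i * r) m; have dj := divn_eq (j * r) m.
rewrite -/(y i) in di; rewrite -/(y j) in dj.
have ymi : (y i < m)%N by rewrite ltn_mod.
have ymj : (y j < m)%N by rewrite ltn_mod.
(* Monotone quotients: the natural subtraction of quotients below does not truncate. *)
have qij : (((i * r) %/ m) <= ((j * r) %/ m))%N.
  by apply: leq_div2r; rewrite leq_mul2r (ltnW lij) orbT.
exists (j - i)%N; first by have := ltn_ord j; lia.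
have [yij|yji] := leqP (y i) (y j).
  left; have -> : ((j - i) * r = ((j * r) %/ m - (i * r) %/ m) * m + (y j - y i))%N.
    rewrite !mulnBl; have := leq_mul qij (leqnn m); lia.
  by rewrite modnMDl modn_small ?mulnBr; lia.
right; exists ((j * r) %/ m - (i * r) %/ m)%N, (y i - y j)%N.
split; rewrite ?mulnBl ?mulnBr; try lia.
have := leq_mul qij (leqnn m); have := leq_mul (ltnW lij) (leqnn r); lia.
Qed.

(** The last hypothesis forbids any [k] for which both [N * k] and [N * ((k * r) %% m)] are below
    [m]. This rules out the first alternative of [dirichlet_modn], and in the second one it bounds
    [c] by [N * b]. *)
Lemma linear_relation (N r m : nat) : (0 < r < m)%N -> (0 < N)%N ->
  (N * N < m)%N ->
  (forall k, (0 < k < m)%N -> (2 * m <= N * (k + (k * r) %% m))%N) ->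
  exists a b c, [/\ (0 < a <= b)%N, (b <= N)%N, (0 < c <= N * N)%N,
    coprime a b & (a * m = b * r + c)%N].
Proof.
move=> /andP[r0 rm] N0 NN h.
have m0 : (0 < m)%N by lia.
have [b /andP[b0 bN] [small|[a [c [c0 cm E]]]]] := dirichlet_modn r N0 m0.
  have bm : (b < m)%N by nia.
  have := h b; rewrite b0 bm mulnDr => /(_ isT).
  have := leq_mul (leqnn N) bN; lia.
have a0 : (0 < a)%N by case: a E => //; lia.
have cm' : (c < m)%N by have := leq_mul N0 (leqnn c); lia.
have ab : (a <= b)%N.
  rewrite -ltnS -(ltn_pmul2r m0) E mulSn.
  have := leq_mul (leqnn b) (ltnW rm); lia.
have cN : (c <= N * b)%N.
  (* The residues of [b, 2b, ..., tb] go down by steps of [c] until they are at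
     most [c], within [t <= m / c] steps. *)
  rewrite leqNgt; apply/negP => Nbc.
  have bc : (b <= c)%N by have := leq_mul N0 (leqnn b); lia.
  (* Dividing [m - 1] instead of [m] keeps the last residue [m - t * c] between 1 and [c]. Since
     [N * b < c] and [N * c < m], the index [b * t] is then forbidden by [h]. *)
  pose t := ((m - 1) %/ c)%N.
  have tE := divn_eq (m - 1) c; rewrite -/t in tE.
  have tl := ltn_pmod (m - 1) c0.
  have t0 : (0 < t)%N by rewrite divn_gt0//; lia.
  have btc := leq_mul bc (leqnn t).
  have := h (b * t)%N; rewrite muln_gt0 b0 t0 /=.
  have -> : (b * t < m)%N by lia.
  have -> : (b * t * r = (t * a - 1) * m + (m - t * c))%N.
    have e : (t * (a * m) = t * (b * r) + t * c)%N by rewrite E mulnDr.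
    have ta := leq_mul t0 (leq_mul a0 (leqnn m)).
    rewrite [(b * t)%N]mulnC -[LHS]mulnA mulnBl -[(t * a * m)%N]mulnA; lia.
  rewrite modnMDl modn_small; last lia.
  move=> /(_ isT); rewrite mulnDr.
  have e1 := leq_mul (ltnW Nbc) (leqnn t).
  have e2 : (N * (m - t * c) <= N * c)%N by rewrite leq_mul2l; lia.
  lia.
(* The relation itself makes [d] divide [c], so it can be divided through by [d]. *)
pose d := gcdn a b.
have d0 : (0 < d)%N by rewrite gcdn_gt0 a0.
have da : (d %| a)%N := dvdn_gcdl a b.
have db : (d %| b)%N := dvdn_gcdr a b.
have dc : (d %| c)%N.
  by rewrite -(dvdn_addr _ (dvdn_mulr r db)) -E dvdn_mulr.
exists (a %/ d)%N, (b %/ d)%N, (c %/ d)%N; split.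
- by rewrite divn_gt0// dvdn_leq//= leq_div2r.
- exact: leq_trans (leq_div _ _) bN.
- rewrite divn_gt0// dvdn_leq//=; apply: leq_trans (leq_div _ _) _.
  by apply: leq_trans cN _; rewrite leq_mul2l bN orbT.
- by rewrite /coprime -(eqn_pmul2r d0) muln_gcdl !divnK// mul1n.
- apply/eqP; rewrite -(eqn_pmul2r d0) mulnDl.
  by rewrite mulnAC divnK// E mulnAC !divnK.
Qed.

(** * Bounds on [H] from the linear relation *)

Lemma H_ge (R : realType) (a b c r m : nat) : (1 < m)%N ->
  (0 < c)%N -> (a * m = b * r + c)%N ->
  1 / (maxn c b)%:R <= H R r m.
Proof.
move=> m1 c0 E; apply: le_H => // k /andP[k0 km].
have m0 : (0 < m)%N by lia.
rewrite Hterm_modn// ler_pdivlMr ?ltr0n// mulrAC mul1r.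
rewrite ler_pdivrMr ?ltr0n ?leq_max ?c0// -natrM ler_nat.
set y := ((k * r) %% m)%N.
(* Modulo [m], [b * y] is [b * k * r], and [c * k + b * k * r = k * a * m]. *)
have dv : (m %| c * k + b * y)%N.
  have -> : (m %| c * k + b * y)%N = (m %| c * k + b * (k * r))%N.
    by rewrite /dvdn -modnDmr modnMmr modnDmr.
  by have -> : (c * k + b * (k * r) = k * a * m)%N; [rewrite -mulnA E; nia|rewrite dvdn_mull].
have /(dvdn_leq _) := dv; rewrite addn_gt0 muln_gt0 c0 k0 => /(_ isT) le.
apply: leq_trans le _; rewrite mulnDl ![(_ * maxn _ _)%N]mulnC.
by apply: leq_add; apply: leq_mul; rewrite ?leq_maxl ?leq_maxr.
Qed.

Lemma H_le_point (R : realType) (r m k q y M C : nat) : (0 < M)%N ->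
  (0 < k < m)%N -> (y < m)%N -> (k * r = q * m + y)%N ->
  (M * (k + y) <= m + M * C)%N ->
  H R r m <= 1 / M%:R + C%:R / m%:R.
Proof.
move=> M0 km ym E le; have m0 : (0 < m)%N by lia.
apply: le_trans (H_le _ _ km) _.
rewrite Hterm_modn// E modnMDl modn_small//.
have m0R : (0 < m%:R :> R) by rewrite ltr0n.
have M0R : (0 < M%:R :> R) by rewrite ltr0n.
rewrite ler_pdivrMr// mulrDl divfK ?gt_eqF// -(ler_pM2l M0R).
rewrite mulrDr mulrA mulrA [M%:R * 1]mulrC mul1r divff ?gt_eqF// mul1r.
by rewrite -!natrM -natrD ler_nat.
Qed.

(** A Bezout identity [x * a = s * b + 1] provides an index [x], independent of [m], whose point
    lies on the line [c * k + b * y = m]. If [c <= b], it is already near the intercept [k = 0];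
    otherwise steps [(b, - c)] lead to the intercept [y = 0]. The error constant depends on [a],
    [b], [c] only, so the error vanishes as [m] grows. *)
Lemma H_upper (R : realType) (a b c : nat) : (0 < a)%N -> (0 < b)%N ->
  (0 < c)%N -> coprime a b ->
  exists C, forall r m, (C < m)%N -> (a * m = b * r + c)%N ->
    H R r m <= 1 / (maxn c b)%:R + C%:R / m%:R.
Proof.
move=> a0 b0 c0 /(coprimeP _ a0)[[x s] /= xs].
have x0 : (0 < x)%N by case: x xs => //; lia.
(* The summands [b] and [c * x] ensure [Y >= 1] below; [c * x] also bounds the slack [x] when
   [c <= b], and [c] bounds the slack [y] when [b < c]. *)
exists (b + c + c * x)%N => r m Cm E.
have cx := leq_mul c0 (leqnn x).
have Y0 : (s * m + 1 <= r * x)%N.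
  rewrite -(leq_pmul2l b0).
  have e : (x * (a * m) = x * (b * r) + x * c)%N by rewrite E mulnDr.
  have e' : ((x * a) * m = (s * b + 1) * m)%N by congr muln; lia.
  nia.
pose Y := (r * x - s * m)%N.
have bY : (b * Y + c * x = m)%N.
  have e : (x * (a * m) = x * (b * r) + x * c)%N by rewrite E mulnDr.
  have e' : ((x * a) * m = (s * b + 1) * m)%N by congr muln; lia.
  rewrite /Y mulnBr; nia.
(* The points on the line [c * k + b * y = m] are [(x + b * q, Y - c * q)]. *)
have [cb|bc] := leqP c b.
  have Yb := leq_mul b0 (leqnn Y).
  apply: (@H_le_point R r m x s Y) => //; [lia|lia|rewrite /Y; lia|].
  rewrite !mulnDr; have := leq_mul (leqnn b) cx; rewrite mul1n; lia.
(* With [Y - 1] the descent stops at [1 <= y <= c]; a positive [y] gives [c * k < m], hence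
   [k < m]. *)
pose q := ((Y - 1) %/ c)%N.
have qE := divn_eq (Y - 1) c; rewrite -/q in qE.
have ql := ltn_pmod (Y - 1) c0.
have Y1 : (1 <= Y)%N by rewrite /Y; lia.
pose y := (Y - q * c)%N.
have y0 : (0 < y <= c)%N by rewrite /y; lia.
have YE : (Y = y + q * c)%N by rewrite /y; lia.
have ky : (c * (x + b * q) + b * y = m)%N by rewrite -bY YE; ring.
have by0 := leq_mul b0 (leqnn y).
have kc := leq_mul c0 (leqnn (x + b * q)).
apply: (@H_le_point R r m (x + b * q) (s + q * a) y) => //.
- lia.
- lia.
- have rx : (r * x = s * m + Y)%N by rewrite /Y; lia.
  have qe : (q * (a * m) = q * (b * r) + q * c)%N by rewrite E mulnDr.
  have -> : ((x + b * q) * r = r * x + q * (b * r))%N by ring.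
  rewrite mulnDl -[(q * a * m)%N]mulnA qe rx YE; lia.
- rewrite mulnDr; have := leq_mul (leqnn c) (proj2 (andP y0)).
  rewrite mulnDr; lia.
Qed.

(** * Subsequences and the limit superior *)

(** If each [x] failed from some rank on, all would fail past the largest of these finitely many
    ranks. *)
Lemma infinite_pigeonhole (T : finType) (Q : T -> nat -> Prop) :
  (forall n, exists2 i, (n <= i)%N & exists x, Q x i) ->
  exists x, forall n, exists2 i, (n <= i)%N & Q x i.
Proof.
move=> h; apply: contrapT => /forallNP nh.
have /choice[f fP] x : exists n, forall i, (n <= i)%N -> ~ Q x i.
  have /existsNP[n nP] := nh x; exists n => i ni Qi.
  by apply: nP; exists i.
have [i ni [x Qx]] := h (\max_x f x)%N.
by apply: (fP x i) => //; apply: leq_trans ni; exact: leq_bigmax.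
Qed.

Lemma increasing_subsequence (Q : nat -> Prop) :
  (forall n, exists2 i, (n <= i)%N & Q i) ->
  exists2 u : nat -> nat, {homo u : j k / (j < k)%N} & forall j, Q (u j).
Proof.
move=> h; have /choice[g gP] n : exists i, (n <= i)%N /\ Q i.
  by have [i] := h n; exists i.
exists (fun j => iter j (g \o succn) (g 0%N)).
  by apply: homo_ltn => [? ? ?|j]; [exact: ltn_trans|case: (gP (iter j (g \o succn) (g 0%N)).+1)].
by case=> [|j]; [case: (gP 0%N)|case: (gP (iter j (g \o succn) (g 0%N)).+1)].
Qed.

(** For a real [e] strictly between 0 and the limit superior, a tail bounded by [e] would force the
    limit superior down to [e]. *)
Lemma limn_esup_gt0 (R : realType) (u : nat -> R) :
  (0 < limn_esup (fun i => (u i)%:E))%E ->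
  exists2 e : R, 0 < e & forall n, exists2 i, (n <= i)%N & e < u i.
Proof.
move=> L0; have [e e0 eL] : exists2 e : R, 0 < e &
    (e%:E < limn_esup (fun i => (u i)%:E))%E.
  move: L0; case: (limn_esup _) => [x| |] //=.
    by rewrite lte_fin => x0; exists (x / 2); rewrite ?lte_fin; lra.
  by move=> _; exists 1; rewrite ?ltry.
exists e => // n; apply: contrapT => nh.
move: eL; apply/negP; rewrite -leNgt.
rewrite /limn_esup /limf_esup.
apply: (@le_trans _ _ (ereal_sup [set (u i)%:E | i in [set i | (n <= i)%N]])).
  by apply: ereal_inf_lbound; exists [set i | (n <= i)%N] => //; exists n.
apply: ub_ereal_sup => _ [i /= ni <-]; rewrite lee_fin leNgt.
by apply/negP => ei; apply: nh; exists i.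
Qed.

Unset Implicit Arguments.
Set Strict Implicit.

(* The hypothesis [hrm] is the normalization 0 < r/m <= 1: without it the
   statement fails (r_i = 2 m_i - 1 has H = 1), since a <= b and 0 < c force
   r < m in the conclusion. *)
Theorem theorem3p1 (R : realType) (r m : nat -> nat)
    (hr : forall i, (0 < r i)%N) (hm : forall i, (0 < m i)%N)
    (hrm : forall i, (r i <= m i)%N)
    (hcop : forall i, coprime (r i) (m i))
    (hinf : m i @[i --> \oo] --> \oo)
    (hsup : (0 < limn_esup (fun i : nat => (H R (r i) (m i))%:E))%E) :
  exists a b c : nat,
    [/\ (0 < a)%N, (0 < b)%N, coprime a b, (a <= b)%N & (0 < c)%N] /\
    exists i_ : nat -> nat,
      [/\ {homo i_ : j k / (j < k)%N},
          forall j, (r (i_ j))%:R =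
            (a%:R * (m (i_ j))%:R - c%:R) / b%:R :> R
        & H R (r (i_ j)) (m (i_ j)) @[j --> \oo] --> (1 / (maxn c b)%:R : R)].
Proof.
have mlarge K : exists n, forall i, (n <= i)%N -> (K < m i)%N.
  have [n _ nP] : \forall i \near \oo, (K < m i)%N.
    by apply: (hinf [set j | (K < j)%N]); exists K.+1.
  by exists n.
have [e e0 He] := limn_esup_gt0 hsup.
(* This [N] turns [e < H] into the integer inequality required by [linear_relation]. *)
have [N N0 Ne] : exists2 N, (0 < N)%N & 2 <= N%:R * e :> R.
  exists (Num.trunc (2 / e)).+1 => //.
  by rewrite -ler_pdivrMr// ltW// truncnS_gt.
(* [N] does not depend on [i], so the triples range over one finite type. *)
pose Q (x : 'I_N.+1 * 'I_N.+1 * 'I_(N * N).+1) i :=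
  let: (a, b, c) := x in
  [/\ (0 < a <= b)%N, (0 < c)%N, coprime a b & (a * m i = b * r i + c)%N].
have [|[[a b] c] Qabc] := @infinite_pigeonhole _ Q.
  move=> n; have [n' n'P] := mlarge (N * N + 1)%N.
  have [i /[!geq_max]/andP[ni n'i] ei] := He (maxn n n').
  exists i => //; have mi := n'P _ n'i.
  (* Equality would make the gcd equal to [m i > 1]. *)
  have rm : (r i < m i)%N.
    rewrite ltn_neqAle hrm andbT; apply/eqP => rmi.
    by have := hcop i; rewrite rmi /coprime gcdnn => /eqP; lia.
  have [| |||a [b [c [ab bN cN cop E]]]] := @linear_relation N (r i) (m i) => //.
  - by rewrite hr.
  - lia.
  - move=> k km; have := lt_le_trans ei (H_le R _ km).
    rewrite Hterm_modn// ltr_pdivlMr ?ltr0n// => lt.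
    rewrite -(ler_nat R) !natrM.
    have NR : 0 < N%:R :> R by rewrite ltr0n.
    have mR : 0 <= (m i)%:R :> R by rewrite ler0n.
    move: lt; rewrite -(ltr_pM2l NR) mulrA => /ltW; apply: le_trans.
    by apply: ler_wpM2r.
  have aN : (a < N.+1)%N by lia.
  have cN' : (c < (N * N).+1)%N by lia.
  exists (Ordinal aN, Ordinal (bN : b < N.+1)%N, Ordinal cN') => /=.
  by split => //; lia.
have [_ _ [/andP[a0 ab] c0 cop _]] := Qabc 0%N.
have b0 : (0 < b)%N by exact: leq_trans ab.
exists a, b, c; split=> //.
have [C CP] := H_upper R a0 b0 c0 cop.
(* [C.+1 < m i] gives both [C < m i] for the upper bound and [1 < m i] for the lower one. *)
have [|i_ iinc iP] := @increasing_subsequence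
    (fun i => (C.+1 < m i)%N /\ (a * m i = b * r i + c)%N).
  move=> n; have [n' n'P] := mlarge C.+1.
  have [i /[!geq_max]/andP[ni n'i] [_ _ _ E]] := Qabc (maxn n n').
  by exists i => //; split=> //; exact: n'P.
exists i_; split=> // [j|].
  have [_ E] := iP j; apply: (canRL (mulfK _)); first by rewrite pnatr_eq0 -lt0n.
  by rewrite -natrM E natrD addrK -natrM mulnC.
have i_ge j : (j <= i_ j)%N.
  by elim: j => // j IH; apply: leq_ltn_trans IH _; exact: iinc.
have cvgC : (C%:R / (m (i_ j))%:R : R) @[j --> \oo] --> (0 : R).
  apply/cvgrPdist_lt => eps eps0; have [n nP] := mlarge (Num.trunc (C%:R / eps)).+1.
  exists n => // j /= nj; rewrite sub0r normrN ger0_norm ?divr_ge0//.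
  have mj := nP _ (leq_trans nj (i_ge j)).
  rewrite ltr_pdivrMr ?ltr0n// mulrC -ltr_pdivrMr//.
  by apply: lt_trans (truncnS_gt _) _; rewrite ltr_nat.
apply: (@squeeze_cvgr _ _ _ _ (fun=> 1 / (maxn c b)%:R)
    (fun j => 1 / (maxn c b)%:R + C%:R / (m (i_ j))%:R)).
- apply: nearW => j; have [mj E] := iP j.
  by rewrite (H_ge R _ c0 E) ?CP//; lia.
- exact: cvg_cst.
- by rewrite -[X in _ --> X]addr0; apply: cvgD => //; exact: cvg_cst.
Qed.
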